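(* Let $\Lambda\colon L\times W\to[0,\infty]$ be a dissimilarity, let $\varphi\colon L\to L$ be a parent function, and let $R\colon L\to[0,\infty]$ be a restriction function for $\Lambda$ relative to $\varphi$. If $L$ is finite, then for every $t\in[0,\infty]$ the geometric realization of the inclusion of simplicial complexes $$\iota\colon N(\Lambda,R,\varphi)(t)\to N\Lambda_t$$ is a homotopy equivalence.
   Context: A dissimilarity $\Lambda$ consists of two sets $L$ and $W$ and a function $\Lambda\colon L\times W\to[0,\infty]$ (no further axioms). For $t\in[0,\infty]$, $\Lambda_t=\{(l,w)\in L\times W\mid \Lambda(l,w)<t\}$, and $N\Lambda_t$ is the simplicial complex consisting of all finite $\sigma\subseteq L$ for which there exists $w\in W$ with $\Lambda(l,w)<t$ for all $l\in\sigma$. A function $\varphi\colon L\to L$ is a parent function if $\varphi^n(l)=l$ for some $n>0$ implies $\varphi(l)=l$. Given a dissimilarity $\Lambda\colon L\times W\to[0,\infty]$ and a parent function $\varphi\colon L\to L$, a function $R\colon L\to[0,\infty]$ is a restriction function for $\Lambda$ relative to $\varphi$ if: (1) for all $(l,w)\in L\times W$ with $\Lambda(l,w)<\Lambda(\varphi(l),w)$ we have $\Lambda(\varphi(l),w)\le R(l)$; (2) for every $l\in L$ we have $R(\varphi(l))\ge R(l)$; (3) if $\varphi(l)=l$, then $R(l)=\infty$. Given functions $R\colon L\to[0,\infty]$ and $\varphi\colon L\to L$, an element $l\in L$ is called a slope point if $R(l')<R(l)$ for every $l'\in\varphi^{-1}(l)$. The $(R,\varphi)$-nerve of $\Lambda$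 is the filtered simplicial complex $N(\Lambda,R,\varphi)$ where $N(\Lambda,R,\varphi)(t)$ consists of all $\sigma\in N\Lambda_t$ such that there exists $w\in W$ satisfying: (1) $\Lambda(l,w)<t$ for all $l\in\sigma$; (2) $\Lambda(l,w)\le R(l')$ for all $l,l'\in\sigma$; (3) $\Lambda(l,w)<R(l)$ for all slope points $l$ in $\sigma$. *)

(* Defs.v *)
From HB Require Import structures.
From mathcomp Require Import all_boot all_order all_algebra.
From mathcomp Require Import all_classical all_reals all_analysis.
Import Order.TTheory GRing.Theory Num.Theory.
Import numFieldNormedType.Exports.

Set Implicit Arguments.
Unset Strict Implicit.
Unset Printing Implicit Defensive.

Local Open Scope classical_set_scope.
Local Open Scope ring_scope.

Section HomotopyEquivalence.
Variable K : realType.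

(* Only the values of [H] on [0, 1] x X matter: continuity is that of the
   restriction of [H] to this subspace. *)
Definition homotopic (X Y : topologicalType) (f g : X -> Y) : Prop :=
  exists H : K * X -> Y,
    [/\ {within `[0, 1] `*` [set: X], continuous H},
        forall x, H (0, x) = f x
      & forall x, H (1, x) = g x].

Definition homotopy_equivalence (X Y : topologicalType) (f : X -> Y) : Prop :=
  continuous f /\
  exists g : Y -> X,
    [/\ continuous g, homotopic (g \o f) idfun & homotopic (f \o g) idfun].

End HomotopyEquivalence.

(* Vertices are the l with [set l] a simplex; they need not exhaust [L].
   The empty simplex may or may not belong to the complex; this does not
   affect the geometric realization. *)
Record simplicial_complex (L : finType) := SimplicialComplex {
  simplices :> set {set L};
  simplices_closed : forall s s' : {set L},
    s' \subset s -> simplices s -> simplices s' }.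

Section Realization.
Variables (K : realType) (L : finType).

(* Barycentric coordinates, as a subspace of K^L with the product topology;
   as [L] is finite, this is also the weak topology. *)
Definition realization_set (S : simplicial_complex L) : set {ptws L -> K} :=
  [set x | [/\ forall l, 0 <= x l,
               \sum_(l : L) x l = 1
             & simplices S [set l | x l != 0]%SET]].

Definition realization (S : simplicial_complex L) : topologicalType :=
  set_type (realization_set S).

Lemma realization_set_sub (S T : simplicial_complex L) :
  S `<=` T -> realization_set S `<=` realization_set T.
Proof. by move=> ST x [x0 x1 /ST]. Qed.

Definition realization_incl (S T : simplicial_complex L) (ST : S `<=` T)
    (x : realization S) : realization T :=
  exist _ (\val x) (mem_set (realization_set_sub ST (set_mem (valP x)))).

End Realization.

(* [\bar K] plays the role of [0, oo], nonnegativity being a hypothesis. *)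
Section Nerves.
Variables (K : realType) (L : finType) (W : Type).
Local Open Scope ereal_scope.

Definition parent_function (phi : L -> L) : Prop :=
  forall (l : L) (n : nat), (0 < n)%N -> iter n phi l = l -> phi l = l.

Definition restriction_function (Lambda : L -> W -> \bar K) (phi : L -> L)
    (R : L -> \bar K) : Prop :=
  [/\ forall l w, Lambda l w < Lambda (phi l) w -> Lambda (phi l) w <= R l,
      forall l, R l <= R (phi l)
    & forall l, phi l = l -> R l = +oo].

Definition slope_point (R : L -> \bar K) (phi : L -> L) (l : L) : Prop :=
  forall l', phi l' = l -> R l' < R l.

Definition nerve_simplices (Lambda : L -> W -> \bar K) (t : \bar K) :
    set {set L} :=
  [set s | exists w, forall l, l \in s -> Lambda l w < t].

Lemma nerve_closed Lambda t (s s' : {set L}) :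
  s' \subset s -> nerve_simplices Lambda t s -> nerve_simplices Lambda t s'.
Proof. by move=> /fintype.subsetP ss [w sw]; exists w => l /ss; exact: sw. Qed.

Definition nerve (Lambda : L -> W -> \bar K) (t : \bar K) :
    simplicial_complex L :=
  SimplicialComplex (@nerve_closed Lambda t).

Definition restricted_nerve_simplices (Lambda : L -> W -> \bar K)
    (R : L -> \bar K) (phi : L -> L) (t : \bar K) : set {set L} :=
  [set s | simplices (nerve Lambda t) s /\
    exists w,
      [/\ forall l, l \in s -> Lambda l w < t,
          forall l l', l \in s -> l' \in s -> Lambda l w <= R l'
        & forall l, l \in s -> slope_point R phi l -> Lambda l w < R l]].

Lemma restricted_nerve_closed Lambda R phi t (s s' : {set L}) :
  s' \subset s -> restricted_nerve_simplices Lambda R phi t s ->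
  restricted_nerve_simplices Lambda R phi t s'.
Proof.
move=> s's [Ns [w [h1 h2 h3]]]; split; first exact: simplices_closed Ns.
move/fintype.subsetP in s's; exists w; split.
- by move=> l /s's; exact: h1.
- by move=> l l' /s's ls /s's; exact: h2.
- by move=> l /s's; exact: h3.
Qed.

Definition restricted_nerve (Lambda : L -> W -> \bar K)
    (R : L -> \bar K) (phi : L -> L) (t : \bar K) : simplicial_complex L :=
  SimplicialComplex (@restricted_nerve_closed Lambda R phi t).

Lemma restricted_nerve_sub Lambda R phi t :
  restricted_nerve Lambda R phi t `<=` nerve Lambda t.
Proof. by move=> s []. Qed.

End Nerves.

(* Main.v *)
Require Import Defs.
From HB Require Import structures.
From mathcomp Require Import all_boot all_order all_algebra.
From mathcomp Require Import all_classical all_reals all_analysis.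
Import Order.TTheory GRing.Theory Num.Theory.
Import numFieldNormedType.Exports.

Set Implicit Arguments.
Unset Strict Implicit.
Unset Printing Implicit Defensive.

Local Open Scope classical_set_scope.
Local Open Scope ereal_scope.

(** The proof follows simplicial maps induced by self-maps [f] of the vertex
    set [L].  On barycentric coordinates such an [f] acts by push-forward, and
    contiguous maps (those for which the images of each simplex [s] under [f]
    and [g] lie in a common simplex) induce homotopic maps, along a straight
    line ([contiguous_homotopic]).

    The first axiom of a restriction function says exactly that
    [Lambda (phi l) w <= max (Lambda l w) (R l)] ([parent_le_max]).  Hence a
    simplex of [nerve Lambda t] witnessed by [w] may be enlarged, with the same
    witness, by the parents of those of its vertices [l] that satisfy
    [R l < t].  In the restricted nerve, where the dissimilarities of a simplex
    to its witness are bounded by the least value of [R] on the simplex, this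
    works for the vertices where [R] attains its least value [r < t]: their
    parents satisfy
    [Lambda (phi l) w <= r], which is at most [R] of every vertex involved,
    and the strict inequality at a slope point [phi l] holds because then
    [r = R l < R (phi l)].

    So start with the identity of [L] and repeatedly send the points whose
    current image has minimal [R]-value [r < t] to the parents of these
    images.  Every step is a contiguity in both complexes
    ([climb_nerve_contiguous], [climb_restricted_contiguous]).  The process
    stops, since on [R < t] the map [phi] has no fixed points and climbs
    towards the roots of a forest ([order_parent_lt]).  It ends with a map
    [f], homotopic to the identity in both realizations, whose values all
    satisfy [t <= R] ([climb_to_level]).  On vertices with [t <= R] the extra
    conditions of the restricted nerve follow from [Lambda l w < t], so [f]
    also maps [nerve Lambda t] into the restricted nerve, and this map is a
    homotopy inverse of the inclusion. *)

(** * Homotopies *)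

Section Homotopies.
Local Open Scope ring_scope.

Lemma within_continuous_comp_sub (X Y Z : topologicalType) (A : set X)
    (B : set Y) (f : X -> Y) (g : Y -> Z) :
  continuous f -> A `<=` f @^-1` B ->
  {within B, continuous g} -> {within A, continuous (g \o f)}.
Proof.
move=> cf AB /subspace_continuousP cg; apply/subspace_continuousP => x Ax.
have gfx := cg (f x) (AB x Ax).
move=> U /gfx /= /cf.
rewrite !nbhs_simpl /within /=.
by apply: filterS => y + Ay; apply; exact: AB.
Qed.

Lemma homotopic_refl (K : realType) (X Y : topologicalType) (f : X -> Y) :
  continuous f -> homotopic K f f.
Proof.
move=> cf; exists (f \o snd); split => //.
by apply: continuous_subspaceT => p; apply: (continuous_comp cvg_snd); exact: cf.
Qed.

(** The two homotopies run at double speed on the two halves of the interval;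
    they are glued along the closed cylinders over these halves, which meet
    where both equal [g]. *)
Lemma homotopic_trans (K : realType) (X Y : topologicalType)
    (f g h : X -> Y) :
  homotopic K f g -> homotopic K g h -> homotopic K f h.
Proof.
move=> [F [cF F0 F1]] [G [cG G0 G1]].
pose H (p : K * X) :=
  if p.1 <= 2^-1 then F (2 * p.1, p.2) else G (2 * p.1 - 1, p.2).
exists H; split; last 2 first.
- by move=> x; rewrite /H /= invr_ge0 ler0n mulr0 F0.
- move=> x; rewrite /H /= leNgt invf_lt1 ?ltr1n //= mulr1.
  by rewrite -[2]/(1 + 1) addrK G1.
have closed_cylinder (a b : K) : closed (`[a, b] `*` [set: X]).
  have -> : `[a, b] `*` [set: X] = fst @^-1` [set` `[a, b]].
    by rewrite eqEsubset; split => p //= [].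
  apply: (continuous_closedP _).1; last exact: interval_closed.
  by move=> p; exact: cvg_fst.
pose A : set (K * X) := `[0, 2^-1] `*` [set: X].
pose B : set (K * X) := `[2^-1, 1] `*` [set: X].
have -> : `[0, 1] `*` [set: X] = A `|` B.
  have h1 : (2^-1 : K) <= 1 by rewrite invf_le1 // ler1n.
  have h0 : 0 <= (2^-1 : K) by rewrite invr_ge0.
  rewrite /A /B eqEsubset; split => -[s x] /=; rewrite !in_itv /=.
    case=> /andP[s0 s1] _; case: (leP s 2^-1) => hs; [left|right].
      by rewrite s0.
    by rewrite s1 ltW.
  case=> -[/andP[s0 s1] _]; first by rewrite s0 (le_trans s1).
  by rewrite s1 (le_trans _ s0).
have cscale (c : K) : continuous (fun p : K * X => (2 * p.1 - c, p.2)).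
  move=> p.
  apply: (@cvg_pair _ _ _ _ (nbhs (2 * p.1 - c)) (nbhs p.2)) => /=;
    last exact: cvg_snd.
  apply: cvgB; last exact: cvg_cst.
  by apply: cvgM; [exact: cvg_cst | exact: cvg_fst].
have cscale0 : continuous (fun p : K * X => (2 * p.1, p.2)).
  by move: (cscale 0); under eq_fun do rewrite subr0.
apply: withinU_continuous.
- exact: closed_cylinder.
- exact: closed_cylinder.
- have cFA : {within A, continuous (F \o fun p => (2 * p.1, p.2))}.
    apply: within_continuous_comp_sub cF => //.
    move=> [s x]; rewrite /A /= in_itv => -[/andP[/= s0 s1] _]; split => //=.
    by rewrite in_itv /= mulr_ge0 //= mulrC -ler_pdivlMr // mul1r.
  apply: subspace_eq_continuous cFA => -[s x].
  by rewrite inE /from_subspace /H /= => -[/=]; rewrite in_itv => /andP[_ /= ->].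
- have cGB : {within B, continuous (G \o fun p => (2 * p.1 - 1, p.2))}.
    apply: within_continuous_comp_sub cG => //.
    move=> [s x]; rewrite /B /= in_itv => -[/andP[/= s0 s1] _]; split => //=.
    rewrite in_itv /= subr_ge0 mulrC -ler_pdivrMr // mul1r s0 /=.
    by rewrite lerBlDr -ler_pdivlMr // mulfV.
  apply: subspace_eq_continuous cGB => -[s x].
  rewrite inE /from_subspace /H /= => -[/=]; rewrite in_itv => /andP[/= hs _] _.
  case: leP => // hs'; have -> : s = 2^-1 by apply/le_anti/andP.
  by rewrite divff // subrr G0 F1.
Qed.

End Homotopies.

(** * Realizations of simplicial maps *)

Section SimplicialMaps.
Variables (K : realType) (L : finType).
Implicit Types (S T : simplicial_complex L) (f g : L -> L).
Local Open Scope ring_scope.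

Definition simplicial_map S T f :=
  forall s : {set L}, simplices S s -> simplices T (f @: s)%SET.

Definition contiguous S T f g :=
  forall s : {set L}, simplices S s -> simplices T (f @: s :|: g @: s)%SET.

Lemma contiguous_simplicial S T f g :
  contiguous S T f g -> simplicial_map S T f.
Proof.
by move=> fg s /fg; apply: simplices_closed; exact: finset.subsetUl.
Qed.

Lemma simplicial_map_id S : simplicial_map S S id.
Proof. by move=> s; rewrite imset_id. Qed.

Definition push_forward f (x : {ptws L -> K}) : {ptws L -> K} :=
  fun m => \sum_(l | f l == m) x l.

Definition straight_line f g (s : K) (x : {ptws L -> K}) : {ptws L -> K} :=
  fun m => (1 - s) * push_forward f x m + s * push_forward g x m.

(** The support of a convex combination of two push-forwards lies in the union
    of the images of the support, which contiguity makes a simplex. *)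
Lemma straight_line_realization S T f g s (x : {ptws L -> K}) :
  contiguous S T f g -> 0 <= s <= 1 ->
  realization_set S x -> realization_set T (straight_line f g s x).
Proof.
move=> fg /andP[s0 s1] [x0 x1 xS].
have push_ge0 h m : 0 <= push_forward h x m by apply: sumr_ge0.
have push_sum h : \sum_m push_forward h x m = 1.
  by rewrite -[RHS]x1 [RHS](partition_big h xpredT).
have push_neq0 h m : push_forward h x m != 0 ->
    m \in (h @: [set l | x l != 0])%SET.
  apply: contraNT => /imsetP xm; rewrite /push_forward big1 // => l /eqP hl.
  apply/eqP; apply: contra_notT xm => xl.
  by exists l; rewrite ?inE.
split.
- by move=> m; rewrite addr_ge0 // mulr_ge0 // subr_ge0.
- by rewrite big_split /= -!mulr_sumr !push_sum !mulr1 subrK.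
- apply: simplices_closed (fg _ xS).
  apply/fintype.subsetP => m; rewrite inE finset.in_setU => lm.
  apply: contraR lm; rewrite negb_or => /andP[fm gm].
  rewrite /straight_line (contraNeq (@push_neq0 f m) fm).
  by rewrite (contraNeq (@push_neq0 g m) gm) !mulr0 addr0.
Qed.

Lemma push_forward_realization S T f (x : {ptws L -> K}) :
  simplicial_map S T f ->
  realization_set S x -> realization_set T (push_forward f x).
Proof.
move=> fST xS; have -> : push_forward f x = straight_line f f 0 x.
  by apply: funext => m; rewrite /straight_line subr0 mul1r mul0r addr0.
apply: straight_line_realization xS; last by rewrite lexx ler01.
by move=> s /fST; rewrite finset.setUid.
Qed.

Definition realization_map S T f (fST : simplicial_map S T f)
    (x : realization K S) : realization K T :=
  exist _ (push_forward f (\val x))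
    (mem_set (push_forward_realization fST (set_mem (valP x)))).

Lemma realization_map_id S f (fS : simplicial_map S S f) :
  f =1 id -> realization_map fS =1 id.
Proof.
move=> f_id x; apply: val_inj; apply: funext => m /=.
rewrite /push_forward (eq_bigl (pred1 m)); first by rewrite big_pred1_eq.
by move=> l; rewrite f_id.
Qed.

(** The realization has the initial topology for its coordinates. *)
Lemma continuous_to_realization (X : topologicalType) T
    (h : X -> realization K T) :
  (forall l, continuous (fun x => \val (h x) l)) -> continuous h.
Proof.
move=> ch; apply: continuous_comp_initial => x; apply/cvg_sup => l U.
case=> _ /= [[V oV <-] Vx VU].
have /= := ch l x V (open_nbhs_nbhs (conj oV Vx)).
exact: (@filterS _ (nbhs x) _ _ _ (fun y => VU (\val (h y)))).
Qed.

Lemma continuous_coord S l : continuous (fun x : realization K S => \val x l).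
Proof.
move=> x; apply: (@continuous_comp (realization K S) {ptws L -> K} K
  (fun x => \val x) (@proj L (fun=> K) l)).
  exact: initial_continuous.
exact: proj_continuous.
Qed.

Lemma continuous_push_forward S f m :
  continuous (fun x : realization K S => push_forward f (\val x) m).
Proof.
move=> x; apply: (@cvg_big _ _ _ _ _ (@add_continuous K)).
  exact: nbhs_filter.
by move=> l _; exact: continuous_coord.
Qed.

Lemma continuous_realization_map S T f (fST : simplicial_map S T f) :
  continuous (realization_map fST).
Proof.
by apply: continuous_to_realization => l; exact: continuous_push_forward.
Qed.

Lemma contiguous_homotopic S T f g (fST : simplicial_map S T f)
    (gST : simplicial_map S T g) :
  contiguous S T f g ->
  homotopic K (realization_map fST) (realization_map gST).
Proof.
(* A total homotopy must also have values in the realization for times outside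
   the unit interval, so time is first retracted onto this interval. *)
move=> fg; pose clamp (s : K) : K := Num.min 1 (Num.max 0 s).
have clamp01 s : 0 <= clamp s <= 1.
  by rewrite /clamp le_min ler01 le_max lexx ge_min lexx.
pose H (p : K * realization K S) : realization K T :=
  exist _ (straight_line f g (clamp p.1) (\val p.2))
    (mem_set (straight_line_realization fg (clamp01 p.1) (set_mem (valP p.2)))).
exists H; split.
- apply: continuous_subspaceT; apply: continuous_to_realization => l p.
  have cclamp : continuous (fun q : K * realization K S => clamp q.1).
    have cmax : continuous (fun s : K^o => Num.max 0 s : K^o).
      by move=> s; apply: (@continuous_max K K (cst 0) id);
        [exact: cvg_cst | exact: cvg_id].
    have cmin : continuous (clamp : K^o -> K^o).
      move=> s; apply: (@continuous_min K K (cst 1)); first exact: cvg_cst.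
      exact: cmax.
    by move=> q; apply: (continuous_comp cvg_fst); exact: cmin.
  have cpush h :
      continuous (fun q : K * realization K S => push_forward h (\val q.2) l).
    move=> q; apply: (@continuous_comp _ _ _ snd
      (fun x : realization K S => push_forward h (\val x) l)).
      exact: cvg_snd.
    exact: continuous_push_forward.
  apply: cvgD; apply: cvgM.
  + by apply: cvgB; [exact: cvg_cst | exact: cclamp].
  + exact: cpush.
  + exact: cclamp.
  + exact: cpush.
- move=> x; apply: val_inj; apply: funext => m /=.
  rewrite /straight_line /clamp /=.
  by rewrite maxxx min_r ?ler01 // subr0 mul1r mul0r addr0.
- move=> x; apply: val_inj; apply: funext => m /=.
  rewrite /straight_line /clamp /=.
  by rewrite max_r ?ler01 // minxx subrr mul1r mul0r add0r.
Qed.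

End SimplicialMaps.

Arguments realization_map K {L S T f}.

(** * Climbing towards the roots *)

Section Climbing.
Variables (K : realType) (L : finType) (W : Type).
Variables (Lambda : L -> W -> \bar K) (phi : L -> L) (R : L -> \bar K).
Hypothesis phi_parent : parent_function phi.
Hypothesis R_restriction : restriction_function Lambda phi R.
Variable t : \bar K.

Local Notation nerve_t := (nerve Lambda t).
Local Notation restricted_t := (restricted_nerve Lambda R phi t).

Lemma parent_le_max l w : Lambda (phi l) w <= maxe (Lambda l w) (R l).
Proof.
have [R1 _ _] := R_restriction.
by rewrite le_max; case: leP => //= /R1.
Qed.

(** [order phi l] counts the points of the forward orbit of [l].  The orbit of
    [phi l] is contained in it, and contains [l] only if [l] is periodic,
    hence a fixed point. *)
Lemma order_parent_lt l : phi l != l -> (order phi (phi l) < order phi l)%N.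
Proof.
move=> phil; apply: proper_card; apply/properP; split.
  apply/fintype.subsetP => m; rewrite !inE.
  by apply: connect_trans; exact: fconnect1.
exists l; rewrite !inE ?connect0 //; apply: contra phil => /iter_findex.
by rewrite -iterSr => /phi_parent -> //; rewrite eqxx.
Qed.

Definition climb (r : \bar K) (f : L -> L) (l : L) : L :=
  if R (f l) <= r then phi (f l) else f l.

(** A witness of the image of a simplex under [f] also witnesses the added
    parents, since their dissimilarity to it is at most the maximum of two
    numbers less than [t]. *)
Lemma climb_nerve_contiguous r f :
  r < t -> simplicial_map nerve_t nerve_t f ->
  contiguous nerve_t nerve_t (climb r f) f.
Proof.
move=> rt fN s /fN[w sw]; exists w => l; rewrite finset.in_setU.
case/orP => [/imsetP[k ks ->]|]; last exact: sw.
have fkw : Lambda (f k) w < t by apply: sw; exact: imset_f.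
rewrite /climb; case: ifPn => // Rk; apply: le_lt_trans (parent_le_max _ _) _.
by rewrite gt_max fkw (le_lt_trans Rk rt).
Qed.

(** Either no vertex of the simplex moves, or one of its images has the minimal
    [R]-value [r].  In the second case the bound of the restricted nerve by
    [R] at that image forces the dissimilarities of all images to the witness
    to be at most [r], and then those of the added parents as well; minimality
    of [r] turns this into the bounds by [R] at all the other vertices. *)
Lemma climb_restricted_contiguous r f :
  r < t -> (forall l, r <= R (f l)) ->
  simplicial_map restricted_t restricted_t f ->
  contiguous restricted_t restricted_t (climb r f) f.
Proof.
move=> rt rR fN s sN; have [_ [w [wt wR wslope]]] := fN _ sN.
have [_ Rphi _] := R_restriction.
have [/existsP[l /andP[ls Rl]]|noclimb] :=
    boolP [exists l, (l \in s) && (R (f l) <= r)]; last first.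
  have -> : (climb r f @: s)%SET = (f @: s)%SET.
    apply: eq_in_imset => l ls; rewrite /climb ifN //.
    by apply: contra noclimb => Rl; apply/existsP; exists l; rewrite ls.
  by rewrite finset.setUid; exact: fN.
have fr k : k \in s -> Lambda (f k) w <= r.
  by move=> ks; apply: le_trans Rl; apply: wR; exact: imset_f.
have bounds m : m \in (climb r f @: s :|: f @: s)%SET ->
    [/\ Lambda m w <= r, r <= R m & slope_point R phi m -> Lambda m w < R m].
  rewrite finset.in_setU => mU.
  have fbounds k : k \in s -> [/\ Lambda (f k) w <= r, r <= R (f k)
      & slope_point R phi (f k) -> Lambda (f k) w < R (f k)].
    by move=> ks; split; [exact: fr | exact: rR | apply: wslope; exact: imset_f].
  case/orP: mU => /imsetP[k ks ->]; last exact: fbounds.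
  rewrite /climb; case: ifPn => [Rk|_]; last exact: fbounds.
  have phir : Lambda (phi (f k)) w <= r.
    by apply: le_trans (parent_le_max _ _) _; rewrite ge_max fr.
  split=> [//||slope]; first exact: le_trans (rR k) (Rphi _).
  by apply: le_lt_trans (slope _ erefl); exact: le_trans (rR k).
have Ut m : m \in (climb r f @: s :|: f @: s)%SET -> Lambda m w < t.
  by case/bounds => mr _ _; exact: le_lt_trans rt.
split; first by exists w.
exists w; split => // [m m' /bounds[mr _ _] /bounds[_ rm' _]|m /bounds[] //].
exact: le_trans rm'.
Qed.

(** The sum of the orbit sizes of the values of [f] drops at every step: the
    points that move have [R < t], so they are no fixed points of [phi], and
    at least one point moves. *)
Lemma climb_to_level :
  exists f (fN : simplicial_map nerve_t nerve_t f)
      (fR : simplicial_map restricted_t restricted_t f),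
    [/\ forall l, t <= R (f l),
        homotopic K (realization_map K fN) idfun
      & homotopic K (realization_map K fR) idfun].
Proof.
pose P f := exists (fN : simplicial_map nerve_t nerve_t f)
      (fR : simplicial_map restricted_t restricted_t f),
    homotopic K (realization_map K fN) idfun /\
    homotopic K (realization_map K fR) idfun.
suff climb_from n f : (\sum_l order phi (f l) < n)%N -> P f ->
    exists2 g, P g & forall l, t <= R (g l).
  have [|g [gN [gR [hN hR]]] gt] := @climb_from _ id (ltnSn _).
    exists (@simplicial_map_id _ _), (@simplicial_map_id _ _).
    have map_id S : realization_map K (@simplicial_map_id _ S) = idfun.
      by apply: funext => x; exact: realization_map_id.
    by split; rewrite map_id; apply: homotopic_refl => x; exact: cvg_id.
  by exists g, gN, gR.
elim: n f => // n IHn f fn Pf.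
have [/forallP ft|] := boolP [forall l, t <= R (f l)]; first by exists f.
rewrite negb_forall => /existsP[l0]; rewrite -ltNge => Rl0.
case: (@arg_minP _ _ _ l0 xpredT (fun l => R (f l)) erefl) => l _ lmin.
set r := R (f l) in lmin.
have rt : r < t by apply: le_lt_trans Rl0; exact: lmin.
have [fN [fR [hN hR]]] := Pf.
have [_ _ Rfix] := R_restriction.
have cN := climb_nerve_contiguous rt fN.
have cR := climb_restricted_contiguous rt (fun l => lmin l erefl) fR.
apply: (IHn (climb r f)); last first.
  exists (contiguous_simplicial cN), (contiguous_simplicial cR); split.
    exact: homotopic_trans (contiguous_homotopic K _ _ cN) hN.
  exact: homotopic_trans (contiguous_homotopic K _ _ cR) hR.
rewrite -ltnS; apply: leq_trans fn; rewrite ltnS.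
rewrite (bigD1 l) //= [X in (_ < X)%N](bigD1 l) //= -addSn leq_add //.
  rewrite /climb lexx order_parent_lt //; apply: contraTneq rt => /Rfix rE.
  by rewrite /r rE -leNgt leey.
apply: leq_sum => k _; rewrite /climb; case: ifP => // _.
by have [-> //|/order_parent_lt/ltnW] := eqVneq (phi (f k)) (f k).
Qed.

End Climbing.

(** * The homotopy equivalence *)

Theorem theorem5p9 (K : realType) (L : finType) (W : Type)
    (Lambda : L -> W -> \bar K) (phi : L -> L) (R : L -> \bar K)
    (Lambda_ge0 : forall l w, 0 <= Lambda l w)
    (phi_parent : parent_function phi)
    (R_ge0 : forall l, 0 <= R l)
    (R_restriction : restriction_function Lambda phi R)
    (t : \bar K) (t_ge0 : 0 <= t) :
  homotopy_equivalence K
    (@realization_incl K L (restricted_nerve Lambda R phi t) (nerve Lambda t)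
       (@restricted_nerve_sub K L W Lambda R phi t)).
Proof.
have [f [fN [fR [fRt hN hR]]]] := climb_to_level phi_parent R_restriction t.
(* The values of [f] satisfy [t <= R], so dissimilarities below [t] are also
   below [R] at all vertices of the image. *)
have fNR : simplicial_map (nerve Lambda t) (restricted_nerve Lambda R phi t) f.
  move=> s /fN fs; split => //; have [w sw] := fs.
  exists w; split => // [_ _ /imsetP[k ks ->] /imsetP[k' _ ->]|].
    by apply: le_trans (fRt k'); apply/ltW/sw; exact: imset_f.
  move=> _ /imsetP[k ks ->] _.
  by apply: lt_le_trans (fRt k); apply: sw; exact: imset_f.
split.
  by apply: continuous_to_realization => l; exact: continuous_coord.
exists (realization_map K fNR); split.
- exact: continuous_realization_map.
- rewrite (_ : _ \o _ = realization_map K fR) //.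
  by apply: funext => x; exact: val_inj.
- rewrite (_ : _ \o _ = realization_map K fN) //.
  by apply: funext => x; exact: val_inj.
Qed.
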